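(* Let $J\subseteq\mathbb{Z}[x_0,\dots,x_n]$ be a strongly stable ideal. The functor $\underline{\mathbf{Mf}}_J$ is represented by the scheme $\mathbf{Mf}_J:=\operatorname{Spec}\mathbb{Z}[\mathbf{C}]/\mathfrak{I}_J$. Therefore, for every noetherian ring $A$, a $J$-marked set $F_J$ in $A[\mathbf{x}]$ is a $J$-marked basis if, and only if, the ring homomorphism $\phi_{F_J}:\mathbb{Z}[\mathbf{C}]\to A$ factors through the quotient $\mathbb{Z}[\mathbf{C}]\to\mathbb{Z}[\mathbf{C}]/\mathfrak{I}_J$.
   Context: All rings are commutative, noetherian, with unit. $A[\mathbf{x}]=A[x_0,\dots,x_n]$ with variables ordered $x_0<\dots<x_n$. ${}_A\langle H\rangle$ and ${}_A(H)$ are the $A$-module and the ideal of $A[\mathbf{x}]$ generated by $H$; $D_s$ is the degree-$s$ part of $D$. A monomial ideal $J$ is strongly stable if for every monomial $x^\alpha\in J$, every $x_j\mid x^\alpha$ and every $x_i>x_j$, one has $\frac{x_i}{x_j}x^\alpha\in J$. $\mathcal{B}_J$ is the minimal monomial generating set of $J$ and $\mathcal{N}(J)$ the set of monomials not in $J$; the same letter $J$ denotes the monomial ideal with the same monomials in any $A[\mathbf{x}]$. The functor $\underline{\mathbf{Mf}}_J$ (noetherian rings to sets) sends $A$ to $\{\text{homogeneous ideals } I\subseteq A[\mathbf{x}]\mid A[\mathbf{x}]=I\oplus{}_A\langle\mathcal{N}(J)\rangle\}$ and $A\to B$ to $I\mapsto I\otimes_A B\subseteq B[\mathbf{x}]$.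 A $J$-marked set in $A[\mathbf{x}]$ is a set $F_J=\{f_\alpha=x^\alpha-\sum_{x^\beta\in\mathcal{N}(J)_{|\alpha|}}c_{\alpha\beta}x^\beta\mid x^\alpha\in\mathcal{B}_J\}$ with $c_{\alpha\beta}\in A$. It is a $J$-marked basis if $A[\mathbf{x}]={}_A(F_J)\oplus{}_A\langle\mathcal{N}(J)\rangle$. For an ideal $I$, $\mathcal{N}(J,I):=I\cap{}_A\langle\mathcal{N}(J)\rangle$. $\mathbf{C}$ is the set of $N=\sum_{x^\alpha\in\mathcal{B}_J}|\mathcal{N}(J)_{|\alpha|}|$ variables $C_{\alpha\beta}$, with $x^\alpha\in\mathcal{B}_J$, $x^\beta\in\mathcal{N}(J)_{|\alpha|}$. $\mathcal{I}$ is the ideal of $\mathbb{Z}[\mathbf{C}][\mathbf{x}]$ generated by the $J$-marked set $\mathcal{F}_J:=\{x^\alpha-\sum_{x^\beta\in\mathcal{N}(J)_{|\alpha|}}C_{\alpha\beta}x^\beta\mid x^\alpha\in\mathcal{B}_J\}$. $\mathfrak{I}_J$ is the ideal of $\mathbb{Z}[\mathbf{C}]$ generated by the $\mathbf{x}$-coefficients (coefficients in $\mathbb{Z}[\mathbf{C}]$ of the monomials in $\mathbf{x}$) of all polynomials in $\mathcal{N}(J,\mathcal{I})$, taken over the coefficient ring $\mathbb{Z}[\mathbf{C}]$. For a $J$-marked set $F_J$ in $A[\mathbf{x}]$ with coefficients $c_{\alpha\beta}$, $\phi_{F_J}:\mathbb{Z}[\mathbf{C}]\to A$ is the ring homomorphism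 $C_{\alpha\beta}\mapsto c_{\alpha\beta}$. *)

(* Defs.v *)
From HB Require Import structures.
From mathcomp Require Import all_boot all_order all_algebra.
From mathcomp Require Import finmap.
From mathcomp Require Import boolp classical_sets functions cardinality.
From mathcomp.multinomials Require Import mpoly.

Set Implicit Arguments.
Unset Strict Implicit.
Unset Printing Implicit Defensive.

Import GRing.Theory.
Local Open Scope classical_set_scope.
Local Open Scope ring_scope.

(* Polynomial rings A[x_0, ..., x_n] are {mpoly A[n.+1]}, with x_i = 'X_i for
   i : 'I_n.+1, so that x_j < x_i means (j < i)%N; a monomial x^a is 'X_[a]
   with a : 'X_{1..n.+1}.  Ideals, submodules and sets of monomials are
   classical sets.  A comNzRingType is a nonzero commutative ring. *)

Section Ideals.
Variable R : comNzRingType.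

Definition is_ideal (I : set R) : Prop :=
  [/\ I 0, forall x y, I x -> I y -> I (x + y) & forall a x, I x -> I (a * x)].

Definition ideal_gen (S : set R) : set R := smallest is_ideal S.

Definition noetherian : Prop :=
  forall I, is_ideal I -> exists s : seq R, I = ideal_gen [set` s].

Lemma ideal_genP (S : set R) : is_ideal (ideal_gen S).
Proof.
split=> [I [[]] //|x y Sx Sy I II|a x Sx I II]; have [[_ ID IM] _] := II.
- exact: ID (Sx _ II) (Sy _ II).
- exact: IM (Sx _ II).
Qed.

End Ideals.

Section Submodules.
Variables (A : pzRingType) (V : lmodType A).

Definition is_submodule (M : set V) : Prop :=
  [/\ M 0, forall u v, M u -> M v -> M (u + v) & forall a u, M u -> M (a *: u)].

Definition span (S : set V) : set V := smallest is_submodule S.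

(* V is the internal direct sum of M and N. *)
Definition direct_sum (M N : set V) : Prop :=
  (forall v, exists u w, [/\ M u, N w & v = u + w]) /\
  (forall v, M v -> N v -> v = 0).

End Submodules.

Definition monomials n (A : comNzRingType) (S : set 'X_{1..n.+1}) :
  set {mpoly A[n.+1]} := [set 'X_[a] | a in S].
Arguments monomials {n} A S.

Section MonomialIdeals.
Variable n : nat.
Implicit Types (A : comNzRingType) (a b m : 'X_{1..n.+1}).

Definition strongly_stable (J : set {mpoly int[n.+1]}) : Prop :=
  [/\ is_ideal J,
      J = ideal_gen (monomials int [set a | J 'X_[a]])
    & forall a (i j : 'I_n.+1), J 'X_[a] -> (0 < a j)%N -> (j < i)%N ->
        J 'X_[a - U_(j) + U_(i)]].

Variable J : set {mpoly int[n.+1]}.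

(* The minimal monomial generating set of J, as a set of exponents: the
   monomials of J none of whose proper divisors lies in J.  See mingens_gen
   and mingens_min below. *)
Definition mingens : set 'X_{1..n.+1} :=
  [set a | J 'X_[a] /\ forall b, J 'X_[b] -> (b <= a)%MM -> b = a].

Definition nonmem : set 'X_{1..n.+1} := [set b | ~ J 'X_[b]].

Definition span_nonmem A : set {mpoly A[n.+1]} := span (monomials A nonmem).
Arguments span_nonmem : clear implicits.

(* The pairs (a, b) indexing the coefficients of a J-marked set. *)
Definition coef_pairs : set ('X_{1..n.+1} * 'X_{1..n.+1}) :=
  [set p | [/\ mingens p.1, nonmem p.2 & mdeg p.2 = mdeg p.1]].

(* fset_set enumerates a finite set; coef_pairs is finite when J is a strongly
   stable (or any other) ideal, see finite_coef_pairs and mem_coef_index. *)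
Definition coef_index : {fset 'X_{1..n.+1} * 'X_{1..n.+1}} :=
  fset_set coef_pairs.

(* f_a = x^a - sum_b c_(a,b) x^b, for a family c of coefficients. *)
Definition marked_poly A (c : coef_index -> A) a : {mpoly A[n.+1]} :=
  'X_[a] - \sum_(k : coef_index | (val k).1 == a) c k *: 'X_[(val k).2].

Definition marked_set A (c : coef_index -> A) : set {mpoly A[n.+1]} :=
  [set marked_poly c a | a in mingens].

Definition marked_basis A (c : coef_index -> A) : Prop :=
  direct_sum (ideal_gen (marked_set c)) (span_nonmem A).

Definition homogeneous_ideal A (I : set {mpoly A[n.+1]}) : Prop :=
  is_ideal I /\ I = ideal_gen [set p | I p /\ exists d, p \is d.-homog].

Definition Mf A : set (set {mpoly A[n.+1]}) :=
  [set I | homogeneous_ideal I /\ direct_sum I (span_nonmem A)].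

(* The image of the B-module I (x)_A B in B[x]. *)
Definition Mf_map A (B : comNzRingType) (f : {rmorphism A -> B})
    (I : set {mpoly A[n.+1]}) : set {mpoly B[n.+1]} :=
  span [set map_mpoly f p | p in I].

(* The variables C_(a,b) are numbered by enum_rank on coef_index. *)
Definition ZC : comNzRingType := {mpoly int[#|{: coef_index}|]}.

Definition Cvar (k : coef_index) : ZC := 'X_(enum_rank k).

Definition universal_ideal : set {mpoly ZC[n.+1]} :=
  ideal_gen (marked_set Cvar).

(* The ideal of Z[C] that cuts out the marked scheme. *)
Definition scheme_ideal : set ZC :=
  ideal_gen [set q | exists p m,
    [/\ universal_ideal p, span_nonmem ZC p & q = p@_m]].

Definition phi A (c : coef_index -> A) : ZC -> A :=
  mmap (intmul (1 : A)) (fun i => c (enum_val i)).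

End MonomialIdeals.
Arguments span_nonmem {n} J A.
Arguments universal_ideal {n} J.
Arguments scheme_ideal {n} J.
Arguments Mf {n} J A.
Arguments marked_basis {n} J {A} c.
Arguments phi {n} J {A} c.

(* R represents the functor A |-> F A on noetherian rings, where the functor
   acts on morphisms by Fmap.  A natural bijection Hom(R, A) -> F A is the same
   thing as a natural bijection Hom(Spec A, Spec R) -> F A.  Naturality and
   surjectivity of eta force Fmap f to map F A into F B. *)
Definition represents (R : comNzRingType) (X : comNzRingType -> Type)
    (F : forall A, set (X A))
    (Fmap : forall A B : comNzRingType, {rmorphism A -> B} -> X A -> X B) : Prop :=
  exists eta : forall A : comNzRingType, {rmorphism R -> A} -> X A,
    (forall A, noetherian A -> set_bij [set: {rmorphism R -> A}] (F A) (eta A)) /\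
    (forall (A B : comNzRingType) (f : {rmorphism A -> B}) (g : {rmorphism R -> A}),
      noetherian A -> noetherian B -> eta B (f \o g) = Fmap A B f (eta A g)).

Section MonomialIdealFacts.
Variables (n : nat) (J : set {mpoly int[n.+1]}).
Hypothesis Jid : is_ideal J.
Implicit Types (a b m : 'X_{1..n.+1}).

Lemma ideal_up a b : J 'X_[a] -> (a <= b)%MM -> J 'X_[b].
Proof.
by move=> Ja /submK <-; rewrite mpolyXD; have [_ _ JM] := Jid; apply: JM.
Qed.

Lemma mingens_dvd b : J 'X_[b] -> exists2 a, mingens J a & (a <= b)%MM.
Proof.
have [d] := ubnP (mdeg b); elim: d b => // d IH b /ltnSE ltbd Jb.
case: (pselect (mingens J b)) => [|nB]; first by exists b => //; exact: lepm_refl.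
have [c Jc [cb cNb]] : exists2 c, J 'X_[c] & (c <= b)%MM /\ c <> b.
  apply: contrapT => nE; apply: nB; split=> // c Jc cb.
  by apply: contrapT => cNb; apply: nE; exists c.
have dc : (mdeg c < mdeg b)%N.
  rewrite -(submK cb) mdegD -[X in (X < _)%N]add0n ltn_add2r lt0n mdeg_eq0.
  by apply/eqP => e0; apply: cNb; rewrite -[RHS](submK cb) e0 add0m.
have [a Ba ac] := IH c (leq_trans dc ltbd) Jc.
by exists a => //; exact: lepm_trans ac cb.
Qed.

(* A monomial in the ideal generated by a set of monomials G is divisible by an
   element of G. *)
Lemma monomial_ideal_dvd (G : set 'X_{1..n.+1}) b :
  ideal_gen (monomials int G) 'X_[b] -> exists2 a, G a & (a <= b)%MM.
Proof.
pose D : set 'X_{1..n.+1} := [set b | exists2 a, G a & (a <= b)%MM].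
pose K : set {mpoly int[n.+1]} := [set p | forall m, m \in msupp p -> D m].
move=> /(_ K) Kb; suff : K 'X_[b] by apply; rewrite msuppX inE.
apply: Kb; split; last first.
  by move=> _ [a Ga <-] m; rewrite msuppX inE => /eqP ->; exists a => //; exact: lepm_refl.
split=> [m|p q Kp Kq m|p q Kq m].
- by rewrite msupp0.
- by move=> /msuppD_le; rewrite mem_cat => /orP[/Kp|/Kq].
- move=> /msuppM_le /allpairsP[[m1 m2] /= [_ /Kq[a Ga am] ->]].
  by exists a => //; exact: lepm_trans am (lem_addl _ _).
Qed.

Lemma mingens_gen : J = ideal_gen (monomials int [set a | J 'X_[a]]) ->
  ideal_gen (monomials int (mingens J)) = J.
Proof.
move=> Jmon; have [_ _ GM] := ideal_genP (monomials int (mingens J)).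
apply/seteqP; split; first by apply: smallest_sub => // _ [a [Ja _] <-]; exact: Ja.
rewrite [X in X `<=` _]Jmon; apply: smallest_sub; first exact: ideal_genP.
move=> _ [b Jb <-]; have [a Ba /submK <-] := mingens_dvd Jb.
by rewrite mpolyXD; apply: GM; apply: sub_gen_smallest; exists a.
Qed.

Lemma mingens_min (G : set 'X_{1..n.+1}) :
  ideal_gen (monomials int G) = J -> mingens J `<=` G.
Proof.
move=> GJ a [Ja amin]; rewrite -GJ in Ja.
have [b Gb ba] := monomial_ideal_dvd Ja.
suff <- : b = a by [].
by apply: amin => //; rewrite -GJ; apply: sub_gen_smallest; exists b.
Qed.

(* Dickson's lemma. *)
Lemma nat_monotone_subseq (u : nat -> nat) :
  exists2 g : nat -> nat, {homo g : i j / (i < j)%N}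
    & forall i j, (i < j)%N -> (u (g i) <= u (g j))%N.
Proof.
have minE k : exists i, (k <= i)%N /\ forall j, (k <= j)%N -> (u i <= u j)%N.
  have exP : exists v, `[< exists2 i, (k <= i)%N & u i = v >].
    by exists (u k); apply/asboolP; exists k.
  case: (ex_minnP exP) => v /asboolP[i ki uiv] vmin.
  by exists i; split=> // j kj; rewrite uiv; apply/vmin/asboolP; exists j.
have [f fP] := choice minE.
pose g := fix g k := if k is k'.+1 then f (g k').+1 else f 0%N.
have gS k : (g k < g k.+1)%N by have [] := fP (g k).+1.
have gH : {homo g : i j / (i < j)%N} by apply: homo_ltn => // ? ? ?; exact: ltn_trans.
exists g => // -[|i] j ij; first by have [_] := fP 0%N; apply.
have [fi fm] := fP (g i).+1.
by apply: fm; apply: leq_trans (gS i) _; by apply: ltnW; apply: gH.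
Qed.

Lemma dickson (u : nat -> 'X_{1..n.+1}) :
  exists i j, (i < j)%N /\ (u i <= u j)%MM.
Proof.
suff /(_ n.+1)[g gH gle] k : exists2 g : nat -> nat,
    {homo g : i j / (i < j)%N}
    & forall i j, (i < j)%N -> forall l : 'I_n.+1, (l < k)%N ->
        (u (g i) l <= u (g j) l)%N.
  exists (g 0%N), (g 1%N); split; first exact: gH.
  by apply/mnm_lepP => l; apply: gle.
elim: k => [|k [g gH gle]]; first by exists id.
have [kn|kn] := ltnP k n.+1; last first.
  by exists g => // i j ij l _; apply: gle => //; exact: leq_trans (ltn_ord l) kn.
have [h hH hle] := nat_monotone_subseq (fun i => u (g i) (Ordinal kn)).
exists (g \o h) => [i j ij|i j ij l]; first by apply: gH; apply: hH.
rewrite ltnS leq_eqVlt => /orP[/eqP lk|lk]; last by apply: gle lk; apply: hH.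
have -> : l = Ordinal kn by exact: val_inj.
exact: hle.
Qed.

Lemma finite_mingens : finite_set (mingens J).
Proof.
apply: contrapT => /infiniteP /card_leP[f].
pose u (i : nat) : 'X_{1..n.+1} := val (f (to_setT i)).
have uB i : mingens J (u i) by apply: set_mem; exact: valP.
have [i [j [ij uij]]] := dickson u.
have [[Ji _] [_ minj]] := (uB i, uB j).
have /val_inj /inj /(congr1 val) /= eij := minj _ Ji uij.
by move: ij; rewrite eij ?ltnn ?inE.
Qed.

Lemma finite_coef_pairs : finite_set (coef_pairs J).
Proof.
pose d := (\max_(a <- fset_set (mingens J)) mdeg a)%N.
pose S : set 'X_{1..n.+1} := [set val b | b in [set: 'X_{1..n.+1 < d.+1}]].
apply: (@sub_finite_set _ _ (mingens J `*` S)).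
  move=> [a b] /= [Ba Nb dab]; split=> //=.
  have db : (mdeg b < d.+1)%N.
    rewrite dab ltnS; apply: (leq_bigmax_seq a) => //.
    by rewrite in_fset_set ?inE //; exact: finite_mingens.
  by exists (BMultinom db).
by apply: finite_setX; [exact: finite_mingens|exact/finite_image/finite_finset].
Qed.

Lemma mem_coef_index p : p \in coef_index J <-> coef_pairs J p.
Proof. by rewrite in_fset_set ?inE //; exact: finite_coef_pairs. Qed.

Lemma scheme_ideal_proper : ~ scheme_ideal J 1.
Proof.
have [e eV] : exists e : {rmorphism ZC J -> int}, forall k, e (Cvar k) = 0.
  by exists (mmap (intmul 1) (fun=> 0)) => k; rewrite /= mmapX mmap1U.
pose K : set (ZC J) := [set q | e q = 0].
have KP : is_ideal K.
  split=> [|x y ex ey|a x ex]; rewrite /K /=; first by rewrite rmorph0.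
    by rewrite rmorphD ex ey addr0.
  by rewrite rmorphM ex mulr0.
suff KI : scheme_ideal J `<=` K by move=> /KI /eqP; rewrite rmorph1 oner_eq0.
apply: smallest_sub => // _ [p [m [Up Np ->]]].
pose L : set {mpoly (ZC J)[n.+1]} := [set p | forall m, nonmem J m -> e p@_m = 0].
have [Jm|Nm] := pselect (J 'X_[m]).
  pose M : set {mpoly (ZC J)[n.+1]} := [set p | forall m, J 'X_[m] -> p@_m = 0].
  rewrite /K /=; suff -> : p@_m = 0 by rewrite rmorph0.
  apply: (Np M) => //; split; last first.
    by move=> _ [b Nb <-] b' Jb'; rewrite mcoeffX; case: eqP => // eb; rewrite -eb in Jb'.
  split=> [b _|p1 p2 M1 M2 b Jb|a p1 M1 b Jb]; first exact: mcoeff0.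
    by rewrite mcoeffD M1 ?M2 ?addr0.
  by rewrite mcoeffZ M1 ?mulr0.
suff : L p by apply.
apply: Up; split; last first.
  move=> _ [a [Ja _] <-] b Nb; rewrite /marked_poly mcoeffB mcoeffX.
  have /negbTE -> : a != b by apply: contra_notN Nb => /eqP <-.
  rewrite sub0r rmorphN raddf_sum rmorph_sum big1 ?oppr0 // => k _.
  by rewrite /= mcoeffZ rmorphM eV mul0r.
split=> [b _|p1 p2 L1 L2 b Nb|a p1 L1 b Nb].
- by rewrite mcoeff0 rmorph0.
- by rewrite mcoeffD rmorphD L1 ?L2 ?addr0.
- rewrite mcoeffM rmorph_sum big1 // => -[k1 k2] /= /eqP bE.
  rewrite rmorphM L1 ?mulr0 // => Jk; apply: Nb.
  by apply: ideal_up Jk _; rewrite [X in (_ <= X)%MM]bE; exact: lem_addl.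
Qed.

End MonomialIdealFacts.

Section MarkedScheme.
Variables (n : nat) (J : set {mpoly int[n.+1]}).
Hypothesis Jss : strongly_stable J.

(* Jss occurs here because the quotient of Z[C] is a nonzero ring only when 1 is
   not in the ideal. *)
Definition scheme_pred of strongly_stable J : pred (ZC J) :=
  fun q => `[< scheme_ideal J q >].

Lemma scheme_pred_idealr : idealr_closed (scheme_pred Jss).
Proof.
have [I0 ID IM] := ideal_genP [set q | exists p m,
    [/\ universal_ideal J p, span_nonmem J (ZC J) p & q = p@_m]].
split=> [||a x y].
- exact/asboolP.
- by apply/asboolPn; apply: scheme_ideal_proper; case: Jss.
- by move=> /asboolP Ix /asboolP Iy; apply/asboolP; apply: ID => //; apply: IM.
Qed.

HB.instance Definition _ := isIdealr.Build (ZC J) (scheme_pred Jss) scheme_pred_idealr.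

Definition scheme_idealr : idealr (ZC J) := scheme_pred Jss.

(* Mf_J is the spectrum of Z[C] / scheme_ideal. *)
Definition Mf_ring : comNzRingType := {ideal_quot scheme_idealr}.

Definition Mf_pi : {rmorphism ZC J -> Mf_ring} := \pi_{ideal_quot scheme_idealr}%qT.

Lemma Mf_pi_eq0 q : Mf_pi q = 0 <-> scheme_ideal J q.
Proof.
have E : (Mf_pi q == 0) = scheme_pred Jss q.
  by rewrite [LHS]piE Quotient.equivE subr0.
by split=> [/eqP|Iq]; [rewrite E => /asboolP|apply/eqP; rewrite E; exact/asboolP].
Qed.

End MarkedScheme.

(* Main.v *)
(* Strong stability lets every monomial of J be written x^a x^d, where x^a is a
   minimal generator and no variable of x^d exceeds one of x^a.  Rewriting x^a by
   the tail of f_a produces only monomials outside J and monomials of J whose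
   cofactor x^d is lexicographically smaller, so a marked set always satisfies
   A[x] = (F) + <N(J)>, and being a basis only requires that (F) and <N(J)> meet
   in 0.  Over Z[C] the coefficients of this intersection generate the scheme
   ideal; killing them makes reduction well defined, and reduction commutes with
   base change.  An ideal I in Mf(A) is generated by the marked set
   read off the homogeneous decompositions of the minimal generators along
   I + <N(J)>, and the directness of that sum makes the coefficients unique. *)
Require Import Defs.
From HB Require Import structures.
From mathcomp Require Import all_boot all_order all_algebra.
From mathcomp Require Import finmap.
From mathcomp Require Import boolp classical_sets functions cardinality.
From mathcomp.multinomials Require Import ssrcomplements mpoly.

Set Implicit Arguments.
Unset Strict Implicit.
Unset Printing Implicit Defensive.
Import GRing.Theory.
Local Open Scope classical_set_scope.
Local Open Scope ring_scope.

(** * Closure properties of ideals, submodules and spans *)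

Section IdealFacts.
Variables (R : comNzRingType) (I : set R).
Hypothesis idI : is_ideal I.

Lemma idealN x : I x -> I (- x).
Proof. by have [_ _ IM] := idI; move=> /(IM (-1)); rewrite mulN1r. Qed.

Lemma idealB x y : I x -> I y -> I (x - y).
Proof. by have [_ ID _] := idI; move=> Ix /idealN; apply: ID. Qed.

End IdealFacts.

Section SubmoduleFacts.
Variables (A : pzRingType) (V : lmodType A).

Lemma submodule_sum (M : set V) (T : Type) (s : seq T) (P : pred T) (F : T -> V) :
  is_submodule M -> (forall i, P i -> M (F i)) -> M (\sum_(i <- s | P i) F i).
Proof. by case=> M0 MD _ MF; apply: big_ind. Qed.

Lemma spanP (S : set V) : is_submodule (Defs.span S).
Proof.
split=> [M [[]] //|x y Sx Sy M MM|a x Sx M MM]; have [[_ MD MZ] _] := MM.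
- exact: MD (Sx _ MM) (Sy _ MM).
- exact: MZ (Sx _ MM).
Qed.

Lemma is_submodule_add (M N : set V) : is_submodule M -> is_submodule N ->
  is_submodule [set v | exists u w, [/\ M u, N w & v = u + w]].
Proof.
move=> [M0 MD MZ] [N0 ND NZ]; split.
- by exists 0, 0; rewrite addr0.
- move=> _ _ [u [w [Mu Nw ->]]] [u' [w' [Mu' Nw' ->]]].
  by exists (u + u'), (w + w'); rewrite addrACA; split; [exact: MD|exact: ND|].
- move=> a _ [u [w [Mu Nw ->]]].
  by exists (a *: u), (a *: w); rewrite scalerDr; split; [exact: MZ|exact: NZ|].
Qed.

End SubmoduleFacts.

Section PolynomialIdeals.
Variables (n : nat) (A : comNzRingType).
Implicit Types I : set {mpoly A[n]}.

Lemma ideal_submodule I : is_ideal I -> is_submodule I.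
Proof. by move=> [I0 ID IM]; split=> // a u /(IM a%:MP); rewrite mul_mpolyC. Qed.

(** Polynomials all of whose monomial multiples lie in [K] form an ideal. This bounds an ideal by a
    set known only to be a submodule, testing just monomial multiples of generators. *)
Lemma ideal_genMX (G K : set {mpoly A[n]}) : is_submodule K ->
  (forall g d, G g -> K ('X_[d] * g)) -> ideal_gen G `<=` K.
Proof.
move=> [K0 KD KZ] KG; set L : set {mpoly A[n]} := [set p | forall d, K ('X_[d] * p)].
suff GL : ideal_gen G `<=` L.
  by move=> p /GL /(_ 0%MM); rewrite mpolyX0 mul1r.
apply: smallest_sub => [|g Gg d]; last exact: KG.
split=> [d|p q Lp Lq d|a p Lp d]; first by rewrite mulr0.
  by rewrite mulrDr; apply: KD.
rewrite [a]mpolyE mulr_suml mulr_sumr; apply: submodule_sum => // m _.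
by rewrite -scalerAl -scalerAr mulrA -mpolyXD; apply: KZ.
Qed.

End PolynomialIdeals.

(** * Combinatorics of strongly stable ideals *)

Section StronglyStable.
Variables (n : nat) (J : set {mpoly int[n.+1]}).
Hypothesis hJ : strongly_stable J.
Implicit Types (a b d m : 'X_{1..n.+1}).

(* Dividing by the smallest variables first produces the decomposition. *)
Lemma star_decomposition m : J 'X_[m] ->
  exists a d, [/\ mingens J a, m = (a + d)%MM
    & forall i j, (0 < d i)%N -> (0 < a j)%N -> (i <= j)%N].
Proof.
have [Jid _ Jswap] := hJ.
have [k] := ubnP (mdeg m); elim: k m => // k IH m /ltnSE mk Jm.
case: (pselect (mingens J m)) => [Bm|NBm].
  by exists m, 0%MM; split=> [||i j]; rewrite ?addm0 ?mnm0E.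
have [a Ba am] := mingens_dvd Jm.
have [i0 ai0] : exists i, (a i < m i)%N.
  apply: contrapT => nE; apply: NBm; suff <- : a = m by [].
  apply/mnmP => i; apply/eqP; rewrite eqn_leq (mnm_lepP am) leqNgt.
  by apply/negP => ai; apply: nE; exists i.
have mi0 : (0 < m i0)%N by exact: leq_ltn_trans ai0.
have [l ml lmin] : exists2 l, (0 < m l)%N & forall i, (0 < m i)%N -> (l <= i)%N.
  by case: (arg_minnP (P := fun i => (0 < m i)%N) (@nat_of_ord _) mi0) => l; exists l.
have lm : (U_(l) <= m)%MM.
  by apply/mnm_lepP => i; rewrite mnm1E; case: eqP => // <-.
(* If [a] has a smaller exponent than [m] at [l], it still divides [m - U_(l)]. Otherwise the
   exponents agree there, and strong stability trades one [x_l] of [a] for the larger [x_i0], where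
   [m] has room to spare. *)
have Jl : J 'X_[m - U_(l)].
  have [al|al] := ltnP (a l) (m l).
    apply: (ideal_up Jid (proj1 Ba)); apply/mnm_lepP => i; rewrite mnmBE mnm1E.
    case: eqP => [<-|_]; first by rewrite leq_subRL ?add1n.
    by rewrite subn0; apply: (mnm_lepP am).
  have li0 : (l < i0)%N.
    rewrite ltn_neqAle lmin // andbT; apply/eqP => /val_inj E.
    by rewrite E leqNgt ai0 in al.
  have := Jswap a i0 l (proj1 Ba) (leq_trans ml al) li0.
  move=> Ja; apply: (ideal_up Jid Ja); apply/mnm_lepP => i.
  rewrite mnmDE !mnmBE !mnm1E; case: (eqVneq i0 i) => [<-|_].
    by rewrite -val_eqE /= ltn_eqF // !subn0 addn1.
  by rewrite addn0; apply: leq_sub2r; apply: (mnm_lepP am).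
have dl : (mdeg (m - U_(l))%MM < k)%N.
  by apply: leq_trans mk; rewrite -[X in (_ < mdeg X)%N](submK lm) mdegD mdeg1 addn1.
have [a' [d [Ba' E dP]]] := IH _ dl Jl.
exists a', (d + U_(l))%MM; split=> // [|i j].
  by rewrite addmA -E submK.
(* The new cofactor variable [x_l] is the smallest in [m], and every variable of [a'] occurs in
   [m]. *)
rewrite mnmDE mnm1E; case: (eqVneq l i) => [<- _ a'j|_]; last by rewrite addn0; apply: dP.
apply: lmin; apply: leq_trans a'j _; rewrite -(submK lm) E !mnmDE -addnA.
exact: leq_addr.
Qed.

(* If [d' i > d i] at the last index [i] where they differ, then [a] involves no
   variable below [x_i] and divides [b]. *)
Lemma star_lex a b d d' : mingens J a -> nonmem J b ->
  (forall i j, (0 < d' i)%N -> (0 < a j)%N -> (i <= j)%N) ->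
  (b + d = a + d')%MM ->
  exists i, (d' i < d i)%N /\ forall k : 'I_n.+1, (i < k)%N -> d' k = d k.
Proof.
have [Jid _ _] := hJ; move=> [Ja _] Nb star E.
have [i0 di0] : exists i, d i != d' i.
  apply: contrapT => nE; apply: Nb; suff -> : b = a by [].
  have Ed : d = d'.
    by apply/mnmP => i; apply: contrapT => /eqP ndi; apply: nE; exists i.
  by rewrite -[b](addmK d) E Ed addmK.
case: (arg_maxnP (P := fun i => d i != d' i) (@nat_of_ord _) di0) => i di imax.
have Eabove (k : 'I_n.+1) : (i < k)%N -> d' k = d k.
  move=> ik; apply/eqP; rewrite eq_sym; apply: contraTT ik => /imax.
  by rewrite -leqNgt.
exists i; split=> //; rewrite ltnNge leq_eqVlt (negbTE di) /=; apply/negP => ddi.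
apply: Nb; apply: (ideal_up Jid Ja); apply/mnm_lepP => k.
have /(congr1 (fun m : 'X_{1..n.+1} => m k)) := E; rewrite !mnmDE.
have [ki|ik] := ltnP k i.
  suff -> : a k = 0%N by [].
  apply/eqP; rewrite -leqn0 leqNgt; apply/negP => ak.
  by have := star i k (leq_ltn_trans (leq0n _) ddi) ak; rewrite leqNgt ki.
have dk : (d k <= d' k)%N.
  move: ik; rewrite leq_eqVlt => /orP[/eqP/val_inj <-|/Eabove -> //]; exact: ltnW.
move=> Ek; rewrite -(leq_add2r (d k)) Ek; exact: leq_add.
Qed.

End StronglyStable.

(** * Lexicographic order through base [D] expansions *)

Lemma base_expansion_bound (N D : nat) (u : nat -> nat) :
  (forall k, u k < D)%N -> (\sum_(k < N) u k * D ^ k < D ^ N)%N.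
Proof.
move=> uD; elim: N => [|N IH]; first by rewrite big_ord0.
rewrite big_ord_recr /= expnS; apply: leq_trans (leq_mul (uD N) (leqnn _)).
by rewrite mulSn ltn_add2r.
Qed.

(** The digits of [u] below [i] together contribute less than [D ^ i], the least gain of [v] at
    digit [i]. *)
Lemma base_expansion_ltn (N D i : nat) (u v : nat -> nat) : (i < N)%N ->
  (forall k, u k < D)%N -> (u i < v i)%N -> (forall k, i < k < N -> u k = v k)%N ->
  (\sum_(k < N) u k * D ^ k < \sum_(k < N) v k * D ^ k)%N.
Proof.
move=> iN uD uvi uv; elim: N iN uv => // N IH; rewrite ltnS leq_eqVlt.
rewrite !big_ord_recr /= => /orP[/eqP <- _|iN uv].
  apply: leq_trans (leq_addl _ _).
  apply: leq_trans (leq_mul uvi (leqnn (D ^ i))); rewrite mulSn ltn_add2r.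
  exact: base_expansion_bound.
rewrite uv ?iN ?ltnS ?leqnn // ltn_add2r; apply: IH => // k /andP[ik kN].
by rewrite uv // ik ltnS ltnW.
Qed.

(** * Equality and factorization of ring morphisms *)

Section RingMorphisms.
Variables (R A : comNzRingType).

(** Injectivity of the representing map concerns morphisms as records; apart from the function,
    their fields are proofs. *)
Lemma rmorphism_ext (f g : {rmorphism R -> A}) : f =1 g -> f = g.
Proof.
case: f g => [f cf] [g cg] /= /funext E; subst g; congr GRing.RMorphism.Pack.
case: cf cg => [[a0] [m0]] [[a1] [m1]]; congr GRing.RMorphism.Class.
  by congr Algebra.isNmodMorphism.Axioms_; exact: Prop_irrelevance.
by congr GRing.isMonoidMorphism.Axioms_; exact: Prop_irrelevance.
Qed.

(** For a chosen section [s] of [p], the map [f \o s] is a morphism because [f] takes a single value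
    on each fibre of [p]. *)
Lemma rmorphism_factor (Q : comNzRingType) (p : {rmorphism R -> Q})
    (f : {rmorphism R -> A}) :
  (forall x, exists q, p q = x) -> (forall q, p q = 0 -> f q = 0) ->
  exists psi : {rmorphism Q -> A}, f =1 psi \o p.
Proof.
move=> psurj ker; have [s sK] := choice psurj.
have fs q : f (s (p q)) = f q.
  by apply/eqP; rewrite -subr_eq0 -rmorphB; apply/eqP/ker; rewrite rmorphB sK subrr.
have fsB : zmod_morphism (f \o s).
  by move=> x y /=; rewrite -{1}(sK x) -{1}(sK y) -rmorphB fs rmorphB.
have fsM : monoid_morphism (f \o s).
  split=> [|x y] /=; first by rewrite -(rmorph1 p) fs rmorph1.
  by rewrite -{1}(sK x) -{1}(sK y) -rmorphM fs rmorphM.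
pose F : {rmorphism Q -> A} := HB.pack (f \o s)
  (GRing.isZmodMorphism.Build Q A (f \o s) fsB)
  (GRing.isMonoidMorphism.Build Q A (f \o s) fsM).
by exists F => q; rewrite /= fs.
Qed.

End RingMorphisms.

(** * Linear maps prescribed on monomials, and base change *)

Section LinearExtension.
Variables (n : nat) (A : comNzRingType) (V : lmodType A) (r : 'X_{1..n} -> V).

Definition mpoly_lin (p : {mpoly A[n]}) : V := \sum_(m <- msupp p) p@_m *: r m.

(** A common bound [k] gives several polynomials the same index set, so their sums can be compared
    term by term. *)
Lemma mpoly_linE p k : (msize p <= k)%N ->
  mpoly_lin p = \sum_(m : 'X_{1..n < k}) p@_m *: r m.
Proof.
move=> pk; rewrite /mpoly_lin (big_mksub 'X_{1..n < k}) ?msupp_uniq //=; last first.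
  by move=> x /msize_mdeg_lt /leq_trans; apply.
by rewrite big_rmcond //= => j /memN_msupp_eq0 ->; rewrite scale0r.
Qed.

Lemma mpoly_linD p q : mpoly_lin (p + q) = mpoly_lin p + mpoly_lin q.
Proof.
pose k := maxn (msize (p + q)) (maxn (msize p) (msize q)).
rewrite !(@mpoly_linE _ k) ?leq_max ?leqnn ?orbT // -big_split.
by apply: eq_bigr => m _; rewrite mcoeffD scalerDl.
Qed.

Lemma mpoly_linZ a p : mpoly_lin (a *: p) = a *: mpoly_lin p.
Proof.
pose k := maxn (msize (a *: p)) (msize p).
rewrite !(@mpoly_linE _ k) ?leq_max ?leqnn ?orbT // scaler_sumr.
by apply: eq_bigr => m _; rewrite mcoeffZ scalerA.
Qed.

Lemma mpoly_lin_kernel : is_submodule [set p | mpoly_lin p = 0].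
Proof.
split=> [|p q /= p0 q0|a p /= p0].
- by rewrite /= /mpoly_lin msupp0 big_nil.
- by rewrite mpoly_linD p0 q0 addr0.
- by rewrite mpoly_linZ p0 scaler0.
Qed.

End LinearExtension.

Lemma mpoly_lin_map n n' (A B : comNzRingType) (f : {rmorphism A -> B})
    (r : 'X_{1..n} -> {mpoly A[n']}) (p : {mpoly A[n]}) :
  mpoly_lin (map_mpoly f \o r) (map_mpoly f p) = map_mpoly f (mpoly_lin r p).
Proof.
pose k := maxn (msize (map_mpoly f p)) (msize p).
rewrite !(@mpoly_linE _ _ _ _ _ k) ?leq_max ?leqnn ?orbT // rmorph_sum.
by apply: eq_bigr => m _; rewrite mcoeff_map_mpoly /= map_mpolyZ.
Qed.

Lemma map_ideal_gen n (A B : comNzRingType) (f : {rmorphism A -> B})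
    (S : set {mpoly A[n]}) p :
  ideal_gen S p -> ideal_gen (map_mpoly f @` S) (map_mpoly f p).
Proof.
have [G0 GD GM] := ideal_genP (map_mpoly f @` S).
pose K : set {mpoly A[n]} := [set p | ideal_gen (map_mpoly f @` S) (map_mpoly f p)].
move: p; apply: (@smallest_sub _ _ _ K); last first.
  by move=> p Sp; apply: sub_gen_smallest; exists p.
split=> [|p q Kp Kq|a p Kp]; rewrite /K /=.
- by rewrite rmorph0.
- by rewrite rmorphD; apply: GD.
- by rewrite rmorphM; apply: GM.
Qed.

(** * Homogeneous components *)

Section HomogeneousIdeals.
Variables (n : nat) (A : comNzRingType).

(** By linearity it suffices to look at a monomial times a homogeneous generator, whose degree [d]
    component is either itself or 0. *)
Lemma homogeneous_pihomog (I : set {mpoly A[n.+1]}) d p :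
  homogeneous_ideal I -> I p -> I (pihomog mdeg d p).
Proof.
move=> [idI Igen]; have [I0 ID IM] := idI; have [_ _ IZ] := ideal_submodule idI.
rewrite [X in X p -> _]Igen; move: p.
pose K : set {mpoly A[n.+1]} := [set p | I (pihomog mdeg d p)].
apply: (@ideal_genMX _ _ _ K) => [|g e [Ig [k hg]]].
  split=> [|p q Kp Kq|a p Kp]; rewrite /K /=.
  - by rewrite pihomog0.
  - by rewrite pihomogD; apply: ID.
  - by rewrite linearZ; apply: IZ.
have hXg : 'X_[e] * g \is (mdeg e + k).-homog.
  by apply: dhomogM => //; rewrite dhomogX.
rewrite /K /=; have [E|ne] := eqVneq (mdeg e + k)%N d.
  by rewrite pihomog_dE -?E //; apply: IM.
by rewrite (pihomog_ne0 ne hXg).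
Qed.

End HomogeneousIdeals.

(** * Marked sets under base change, and the universal property of [ZC] *)

Section MarkedSets.
Variables (n : nat) (J : set {mpoly int[n.+1]}).
Implicit Types (A : comNzRingType) (a b d m : 'X_{1..n.+1}).

Lemma span_nonmemP A (p : {mpoly A[n.+1]}) :
  span_nonmem J A p <-> forall m, J 'X_[m] -> p@_m = 0.
Proof.
split=> [Np|p0].
  pose M : set {mpoly A[n.+1]} := [set p | forall m, J 'X_[m] -> p@_m = 0].
  apply: (Np M); split.
    split=> [m _|q1 q2 M1 M2 m Jm|x q Mq m Jm]; first exact: mcoeff0.
      by rewrite mcoeffD M1 ?M2 ?addr0.
    by rewrite mcoeffZ Mq ?mulr0.
  move=> _ [b Nb <-] m Jm; rewrite mcoeffX; case: eqP => // bm.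
  by case: Nb; rewrite bm.
have sM := spanP (monomials A (nonmem J)); have [M0 _ MZ] := sM.
rewrite [p]mpolyE; apply: submodule_sum => // m _.
have [Jm|Nm] := pselect (J 'X_[m]); first by rewrite p0 // scale0r.
by apply: MZ; apply: sub_gen_smallest; exists m.
Qed.

Lemma span_nonmem_submodule A : is_submodule (span_nonmem J A).
Proof. exact: spanP. Qed.

Lemma span_nonmemX A m : nonmem J m -> span_nonmem J A 'X_[m].
Proof. by move=> Nm; apply: sub_gen_smallest; exists m. Qed.

Lemma span_nonmem_map A (B : comNzRingType) (f : {rmorphism A -> B}) p :
  span_nonmem J A p -> span_nonmem J B (map_mpoly f p).
Proof.
move=> /span_nonmemP Np; apply/span_nonmemP => m /Np.
by rewrite mcoeff_map_mpoly => ->; exact: rmorph0.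
Qed.

Lemma span_nonmem_pihomog A k (p : {mpoly A[n.+1]}) :
  span_nonmem J A p -> span_nonmem J A (pihomog mdeg k p).
Proof.
have [M0 _ MZ] := span_nonmem_submodule A.
move=> /span_nonmemP Np; rewrite pihomogE; apply: submodule_sum => [|m _].
  exact: span_nonmem_submodule.
have [/Np -> |Nm] := pselect (J 'X_[m]); first by rewrite scale0r.
by apply: MZ; apply: span_nonmemX.
Qed.

Lemma map_marked_poly A (B : comNzRingType) (f : {rmorphism A -> B})
    (c : coef_index J -> A) a :
  map_mpoly f (marked_poly c a) = marked_poly (f \o c) a.
Proof.
rewrite /marked_poly rmorphB rmorph_sum /= map_mpolyX; congr (_ - _).
by apply: eq_bigr => k _; rewrite map_mpolyZ map_mpolyX.
Qed.

Lemma map_marked_set A (B : comNzRingType) (f : {rmorphism A -> B})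
    (c : coef_index J -> A) :
  map_mpoly f @` marked_set c = marked_set (f \o c).
Proof.
apply/seteqP; split.
  by move=> _ [_ [a Ba <-] <-]; exists a; rewrite ?map_marked_poly.
by move=> _ [a Ba <-]; exists (marked_poly c a); [exists a|exact: map_marked_poly].
Qed.

(** This yields naturality of the representing map. From right to left, monomial multiples of the
    generators span the ideal over [B], and each is the image of one over [A]. *)
Lemma Mf_map_marked_set A (B : comNzRingType) (f : {rmorphism A -> B})
    (c : coef_index J -> A) :
  Mf_map f (ideal_gen (marked_set c)) = ideal_gen (marked_set (f \o c)).
Proof.
apply/seteqP; split.
  apply: smallest_sub; first by apply: ideal_submodule; exact: ideal_genP.
  by move=> _ [p Gp <-]; rewrite -map_marked_set; apply: map_ideal_gen.
apply: ideal_genMX; first exact: spanP.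
move=> _ e [a Ba <-]; apply: sub_gen_smallest; exists ('X_[e] * marked_poly c a).
  have [_ _ GM] := ideal_genP (marked_set c).
  by apply: GM; apply: sub_gen_smallest; exists a.
by rewrite rmorphM /= map_mpolyX map_marked_poly.
Qed.

Lemma phi_Cvar A (c : coef_index J -> A) k : phi J c (Cvar k) = c k.
Proof. by rewrite /phi /Cvar mmapX mmap1U enum_rankK. Qed.

Definition phi_rmorphism A (c : coef_index J -> A) : {rmorphism ZC J -> A} :=
  mmap (intmul (1 : A)) (fun i => c (enum_val i)).

(** Uniqueness in the universal property of Z[C]: integers have forced images, so the variables
    determine the morphism. *)
Lemma rmorphism_phi A (f : {rmorphism ZC J -> A}) (c : coef_index J -> A) :
  (forall k, f (Cvar k) = c k) -> f =1 phi J c.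
Proof.
move=> fc q; change (f q = phi_rmorphism c q).
rewrite [q]mpolyE !rmorph_sum; apply: eq_bigr => m _.
rewrite -mul_mpolyC !rmorphM -[q@_m]intz !rmorph_int; congr (_ * _).
rewrite mpolyXE_id !rmorph_prod; apply: eq_bigr => i _; rewrite !rmorphXn.
by rewrite -[i]enum_valK [f _]fc [phi_rmorphism c _]phi_Cvar.
Qed.

End MarkedSets.

(** * Reduction, the basis criterion, and recovery of the marked set from its ideal *)

Section MarkedBases.
Variables (n : nat) (J : set {mpoly int[n.+1]}).
Hypothesis hJ : strongly_stable J.
Implicit Types (A : comNzRingType) (a b d m : 'X_{1..n.+1}).

Lemma coef_indexP (k : coef_index J) : coef_pairs J (val k).
Proof. by apply/mem_coef_index; exact: valP. Qed.

Section Tail.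
Variables (A : comNzRingType) (c : coef_index J -> A).

Definition marked_tail a : {mpoly A[n.+1]} :=
  \sum_(k : coef_index J | (val k).1 == a) c k *: 'X_[(val k).2].

Lemma mcoeff_marked_tail (k : coef_index J) :
  (marked_tail (val k).1)@_((val k).2) = c k.
Proof.
rewrite raddf_sum (bigD1 k) //= mcoeffZ mcoeffX eqxx mulr1 big1 ?addr0 //.
move=> k' /andP[/eqP E1 nk]; rewrite mcoeffZ mcoeffX; case: eqP => [E2|]; last by rewrite mulr0.
case/eqP: nk; apply: val_inj; apply/eqP; rewrite -pair_eqE.
by apply/andP; split; apply/eqP.
Qed.

Lemma mcoeff_marked_tail0 a m : ~ coef_pairs J (a, m) -> (marked_tail a)@_m = 0.
Proof.
move=> nam; rewrite raddf_sum big1 // => k /eqP ka; rewrite /= mcoeffZ mcoeffX.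
case: eqP => [km|]; last by rewrite mulr0.
by case: nam; rewrite -ka -km; have := coef_indexP k; rewrite -surjective_pairing.
Qed.

Lemma span_nonmem_marked_tail a : span_nonmem J A (marked_tail a).
Proof. by apply/span_nonmemP => m Jm; apply: mcoeff_marked_tail0 => -[_ /=]. Qed.

Lemma dhomog_marked_tail a : marked_tail a \is (mdeg a).-homog.
Proof.
apply: rpred_sum => k /eqP <-; apply: dhomogZ; rewrite dhomogX; apply/eqP.
by have [_ _] := coef_indexP k.
Qed.

Lemma dhomog_marked_poly a : marked_poly c a \is (mdeg a).-homog.
Proof. by apply: rpredB; [rewrite dhomogX|exact: dhomog_marked_tail]. Qed.

Lemma homogeneous_marked_set : homogeneous_ideal (ideal_gen (marked_set c)).
Proof.
split; first exact: ideal_genP.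
apply/seteqP; split; apply: smallest_sub; [exact: ideal_genP| |exact: ideal_genP|by move=> p []].
move=> _ [a Ba <-]; apply: sub_gen_smallest; split; last first.
  by exists (mdeg a); exact: dhomog_marked_poly.
by apply: sub_gen_smallest; exists a.
Qed.

(* For D larger than all exponents, this orders the d lexicographically with x_n
   as the most significant variable. *)
Let weight D d := (\sum_(i < n.+1) d (inord i) * D ^ i)%N.

Lemma marked_decomposition (p : {mpoly A[n.+1]}) : exists u w,
  [/\ ideal_gen (marked_set c) u, span_nonmem J A w & p = u + w].
Proof.
pose G := ideal_gen (marked_set c).
pose M : set {mpoly A[n.+1]} :=
  [set p | exists u w, [/\ G u, span_nonmem J A w & p = u + w]].
have idG : is_ideal G by exact: ideal_genP.
have sG := ideal_submodule idG; have sN := span_nonmem_submodule J A.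
have [[G0 _ _] [N0 _ _]] := (sG, sN).
have sM : is_submodule M by exact: is_submodule_add.
have [_ MD MZ] := sM.
have GM q : G q -> M q by exists q, 0; rewrite addr0.
have NM q : span_nonmem J A q -> M q by exists 0, q; rewrite add0r.
suff MX m : M ('X_[m]).
  by change (M p); rewrite [p]mpolyE; apply: submodule_sum => // m _; apply: MZ.
have [Jm|Nm] := pselect (J 'X_[m]); last by apply: NM; exact: span_nonmemX.
(* Rewriting preserves the total degree, so this [D] exceeds every exponent that can appear. *)
pose D := (mdeg m).+1.
suff main W a d : mingens J a -> mdeg (a + d)%MM = mdeg m -> (weight D d < W)%N ->
    M 'X_[a + d].
  by have [a [d [Ba E _]]] := star_decomposition hJ Jm; rewrite E; apply: main; rewrite -?E.
elim: W a d => // W IH a d Ba dm /ltnSE dW.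
have -> : 'X_[a + d] = 'X_[d] * marked_poly c a + 'X_[d] * marked_tail a :> {mpoly A[n.+1]}.
  by rewrite -mulrDr subrK addmC mpolyXD.
apply: MD.
  by apply: GM; have [_ _] := idG; apply; rewrite /G; apply: sub_gen_smallest; exists a.
rewrite mulr_sumr; apply: submodule_sum => // k /eqP ka.
rewrite -scalerAr -mpolyXD addmC; apply: MZ.
have [_ Nb db] := coef_indexP k; set b := (val k).2 in Nb db *; rewrite ka in db.
have [Jbd|Nbd] := pselect (J 'X_[b + d]); last by apply: NM; exact: span_nonmemX.
have [a' [d' [Ba' E star]]] := star_decomposition hJ Jbd.
have dE : mdeg (a' + d')%MM = mdeg m by rewrite -E mdegD db -mdegD.
have [i [di dgt]] := star_lex hJ Ba' Nb star E.
rewrite E; apply: IH => //; apply: leq_trans dW.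
apply: (base_expansion_ltn (u := fun k => d' (inord k)) (v := fun k => d (inord k))
  (ltn_ord i)) => [k'||k' /andP[ik kn]].
(* Out of range, [inord] still returns a valid index, so the bound holds for every [k']. *)
- rewrite ltnS -dE mdegD; apply: leq_trans (leq_addl _ _).
  by rewrite mdegE (bigD1 (inord k')) //= leq_addr.
- by rewrite inord_val.
- by apply: dgt; rewrite inordK.
Qed.

End Tail.

(* Over Z[C], choose for each monomial a remainder modulo [universal_ideal].  The
   remainders depend on choices only modulo [scheme_ideal], so they specialize
   to a well-defined normal form as soon as [phi] kills [scheme_ideal]. *)
Lemma marked_basisP A (c : coef_index J -> A) :
  marked_basis J c <-> (forall q, scheme_ideal J q -> phi J c q = 0).
Proof.
pose f : {rmorphism ZC J -> A} := phi_rmorphism c.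
have fC : f \o @Cvar n J = c by apply/funext => k; exact: phi_Cvar.
have fU p : universal_ideal J p -> ideal_gen (marked_set c) (map_mpoly f p).
  by move/(map_ideal_gen (f := f)); rewrite map_marked_set fC.
split=> [[_ cap0]|ker].
  pose K : set (ZC J) := [set q | f q = 0].
  have idK : is_ideal K.
    split=> [|x y fx fy|a x fx]; rewrite /K /=; first by rewrite rmorph0.
      by rewrite rmorphD fx fy addr0.
    by rewrite rmorphM fx mulr0.
  apply: (@smallest_sub _ _ _ K) => // _ [p [m [Up Np ->]]].
  have fp0 : map_mpoly f p = 0 by apply: cap0; [exact: fU|exact: span_nonmem_map].
  by change (f p@_m = 0); rewrite -(mcoeff_map_mpoly f) fp0 mcoeff0.
split=> [|u Fu Nu]; first exact: marked_decomposition.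
have kerN p : universal_ideal J p -> span_nonmem J (ZC J) p -> map_mpoly f p = 0.
  move=> Up Np; apply/mpolyP => m; rewrite mcoeff_map_mpoly mcoeff0; apply: ker.
  by apply: sub_gen_smallest; exists p, m.
have idU : is_ideal (universal_ideal J) by exact: ideal_genP.
have sU := ideal_submodule idU; have [_ _ UZ] := sU.
have [N0 ND NZ] := span_nonmem_submodule J (ZC J).
have /choice[r rP] m : exists w, span_nonmem J (ZC J) w /\ universal_ideal J ('X_[m] - w).
  have [v [w [Uv Nw E]]] := marked_decomposition (@Cvar n J) 'X_[m].
  by exists w; rewrite E addrK.
(* Replacing monomials by their remainders changes [p] only by an element of the universal ideal. *)
have U_lin p : universal_ideal J p -> universal_ideal J (mpoly_lin r p).
  move=> Up; have -> : mpoly_lin r p = p - \sum_(m <- msupp p) p@_m *: ('X_[m] - r m).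
    rewrite [X in X - _]mpolyE -sumrB; apply: eq_bigr => m _.
    by rewrite scalerBr opprB addrC subrK.
  apply: (idealB idU Up); apply: submodule_sum => // m _; apply: UZ.
  exact: (proj2 (rP m)).
have N_lin p : span_nonmem J (ZC J) (mpoly_lin r p).
  by apply: submodule_sum => // m _; apply: NZ; exact: (proj1 (rP m)).
(* The specialized normal form kills the marked ideal: a monomial multiple of a generator lifts to
   Z[C], where its normal form lies in the intersection that [f] kills. *)
have NF0 : mpoly_lin (map_mpoly f \o r) u = 0.
  move: u Fu {Nu}; apply: ideal_genMX; first exact: mpoly_lin_kernel.
  move=> _ d [a Ba <-].
  have -> : 'X_[d] * marked_poly c a = map_mpoly f ('X_[d] * marked_poly (@Cvar n J) a).
    by rewrite rmorphM /= map_mpolyX map_marked_poly fC.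
  rewrite /= mpoly_lin_map kerN //; apply: U_lin.
  by have [_ _] := idU; apply; rewrite /universal_ideal; apply: sub_gen_smallest; exists a.
(* The normal form also fixes [u]: for [m] outside [J], the difference of ['X_[m]] and [r m] lies in
   the same intersection. *)
rewrite -NF0 [LHS]mpolyE; apply: eq_bigr => m _.
have [Jm|Nm] := pselect (J 'X_[m]); first by move/span_nonmemP: Nu => -> //; rewrite !scale0r.
congr (_ *: _); rewrite -(map_mpolyX f) /=; apply/eqP; rewrite -subr_eq0 -rmorphB.
apply/eqP/kerN; first exact: (proj2 (rP m)).
apply: ND; first exact: span_nonmemX.
by rewrite -scaleN1r; apply: NZ; exact: (proj1 (rP m)).
Qed.

(** [Mf_pi] is onto with kernel [scheme_ideal], so factoring through it means killing that ideal. *)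
Lemma marked_basis_factor A (c : coef_index J -> A) :
  marked_basis J c <->
  exists psi : {rmorphism Mf_ring hJ -> A}, phi J c =1 psi \o Mf_pi hJ.
Proof.
split=> [/marked_basisP ker|[psi psiE]].
  apply: (rmorphism_factor (f := phi_rmorphism c)) => [x|q /Mf_pi_eq0]; last exact: ker.
  by exists (repr x); exact: reprK.
by apply/marked_basisP => q /(Mf_pi_eq0 hJ) q0; rewrite psiE /= q0 rmorph0.
Qed.

(** Both tails of a generator are remainders of the same monomial modulo the common ideal, so their
    difference lies in an intersection that is 0. *)
Lemma marked_basis_inj A (c c' : coef_index J -> A) : marked_basis J c ->
  ideal_gen (marked_set c) = ideal_gen (marked_set c') -> c = c'.
Proof.
move=> [_ cap0] E; apply/funext => k; have [Ba Nb _] := coef_indexP k.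
pose a := (val k).1.
have idG := ideal_genP (marked_set c); have [_ ND NZ] := span_nonmem_submodule J A.
have : marked_tail c a - marked_tail c' a = 0.
  apply: cap0; last first.
    by apply: ND; rewrite -?scaleN1r; [|apply: NZ]; exact: span_nonmem_marked_tail.
  have -> : marked_tail c a - marked_tail c' a = marked_poly c' a - marked_poly c a.
    by rewrite /marked_poly [RHS]addrC opprB addrA subrK.
  apply: (idealB idG); last by apply: sub_gen_smallest; exists a.
  by rewrite E; apply: sub_gen_smallest; exists a.
move=> /(congr1 (mcoeff (val k).2)).
by rewrite mcoeffB mcoeff0 !mcoeff_marked_tail => /eqP; rewrite subr_eq0 => /eqP.
Qed.

Lemma Mf_marked_basis A (I : set {mpoly A[n.+1]}) : Mf J A I ->
  exists2 c : coef_index J -> A, marked_basis J c & I = ideal_gen (marked_set c).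
Proof.
move=> [hI [Idec cap0]]; have [idI _] := hI.
have /choice[r rP] a : exists w, [/\ w \is (mdeg a).-homog, span_nonmem J A w & I ('X_[a] - w)].
  have [u [w [Iu Nw E]]] := Idec 'X_[a].
  (* Only the part of [w] in the degree of [x^a] may enter a marked polynomial; homogeneity of [I]
     keeps the relation. *)
  exists (pihomog mdeg (mdeg a) w); split; first exact: pihomogP.
    exact: span_nonmem_pihomog.
  have -> : 'X_[a] - pihomog mdeg (mdeg a) w = pihomog mdeg (mdeg a) u.
    have Xh : ('X_[a] : {mpoly A[n.+1]}) \is (mdeg a).-homog by rewrite dhomogX.
    by rewrite -[X in X - _](pihomog_dE Xh) -pihomogB E addrK.
  exact: homogeneous_pihomog.
pose c (k : coef_index J) := (r (val k).1)@_(val k).2.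
have tailE a : mingens J a -> marked_tail c a = r a.
  move=> Ba; have [rh /span_nonmemP rN _] := rP a; apply/mpolyP => m.
  have [am|nam] := pselect (coef_pairs J (a, m)).
    have ami : (a, m) \in coef_index J by exact/(mem_coef_index J).
    exact: (mcoeff_marked_tail c [` ami]%fset).
  rewrite mcoeff_marked_tail0 //.
  have [Jm|Nm] := pselect (J 'X_[m]); first by rewrite rN.
  by rewrite (dhomog_nemf_coeff rh) //; apply/eqP => dm; apply: nam.
have GI : ideal_gen (marked_set c) `<=` I.
  apply: smallest_sub => // _ [a Ba <-].
  by rewrite /marked_poly -/(marked_tail c a) tailE //; have [_ _] := rP a.
have IG : I = ideal_gen (marked_set c).
  apply/seteqP; split=> // p Ip.
  (* As the marked ideal is contained in [I], the remainder [w] of [p] lies in [I] as well, hence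
     vanishes. *)
  have [u [w [Gu Nw E]]] := marked_decomposition c p.
  suff w0 : w = 0 by rewrite E w0 addr0.
  apply: cap0 => //; have -> : w = p - u by rewrite E addrC addKr.
  by apply: (idealB idI) => //; exact: GI.
by exists c => //; rewrite /marked_basis -IG.
Qed.

End MarkedBases.

Theorem theorem2p6 (n : nat) (J : set {mpoly int[n.+1]})
    (hJ : strongly_stable J) :
  represents (Mf_ring hJ) (Mf J) (@Mf_map n) /\
  (forall (A : comNzRingType) (c : coef_index J -> A), noetherian A ->
     (marked_basis J c <->
      exists psi : {rmorphism Mf_ring hJ -> A},
        phi J c =1 psi \o Mf_pi hJ)).
Proof.
split; last by move=> A c _; exact: marked_basis_factor.
(* A point [g] of the scheme is read as the marked set whose coefficients are its values at the
   classes of the variables. *)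
pose cf (A : comNzRingType) (g : {rmorphism Mf_ring hJ -> A}) (k : coef_index J) :=
  g (Mf_pi hJ (Cvar k)).
exists (fun A g => ideal_gen (marked_set (cf A g))); split; last first.
  by move=> A B f g _ _; rewrite Mf_map_marked_set.
move=> A _.
have basis g : marked_basis J (cf A g).
  apply/(marked_basis_factor hJ); exists g => q.
  by apply/esym/(rmorphism_phi (f := g \o Mf_pi hJ)).
split.
- by move=> g _; split; [exact: homogeneous_marked_set|exact: basis].
- move=> g g' _ _ /(marked_basis_inj (basis g)) E; apply: rmorphism_ext => x.
  have <- : Mf_pi hJ (repr x) = x by exact: reprK.
  rewrite -[LHS]/((g \o Mf_pi hJ) _) -[RHS]/((g' \o Mf_pi hJ) _).
  rewrite (rmorphism_phi (c := cf A g)) // (rmorphism_phi (c := cf A g)) // => k.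
  by rewrite E.
- move=> I /(Mf_marked_basis hJ)[c /(marked_basis_factor hJ)[psi psiE] ->].
  exists psi => //; congr (ideal_gen (marked_set _)); apply/funext => k.
  by rewrite -(phi_Cvar c) psiE.
Qed.
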